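(* Assume $\delta=d$ and $\gamma\ge1$. Then for every $(z,w)\in A_f$, $$\lim_{n\to\infty}\frac{1}{n\gamma d^{n-1}}\log|Q_z^n(w)|=G_p(z).$$
   Context: Let $p(z)=z^d+O(z^{d-1})$ be a monic polynomial of degree $\delta=d\ge 2$, and let $q(z,w)=b(z)w^d+(\text{terms of lower degree in } w)$ be a polynomial with $\deg_w q=d$, where $b$ is a monic polynomial of degree $\gamma$. Let $f(z,w)=(p(z),q(z,w))$. Write $Q_z^n=q_{p^{n-1}(z)}\circ\cdots\circ q_{p(z)}\circ q_z$ with $q_z=q(z,\cdot)$, so $f^n(z,w)=(p^n(z),Q_z^n(w))$. Let $A_p=\{z: p^n(z)\to\infty\}$ and $G_p(z)=\lim_n d^{-n}\log^+|p^n(z)|$. Define $\alpha=\max\{(n_j-\gamma)/(d-m_j)\}$ over monomials $z^{n_j}w^{m_j}$ appearing in $q$ with nonzero coefficient and $m_j<d$, and $\alpha=-\infty$ if $q=b(z)w^d$. Let $W_R=\{(z,w):|z|>R,\ |w|>R|z|^\alpha\}$ (if $\alpha=-\infty$: $\{|z|>R,\ w\ne0\}$), fix $R>1$ large enough that $f(W_R)\subset W_R$ and $W_R\subset A_p\times\mathbb{C}$, and set $A_f=\bigcup_{n\ge0}f^{-n}(W_R)$. *)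

(* Defs.v *)
From Stdlib Require Import Reals Lra Lia List.
Import ListNotations.
Open Scope R_scope.

Definition Cx : Type := (R * R)%type.
Definition Czero : Cx := (0, 0).
Definition Cone : Cx := (1, 0).
Definition Cadd (u v : Cx) : Cx := (fst u + fst v, snd u + snd v).
Definition Cmul (u v : Cx) : Cx :=
  (fst u * fst v - snd u * snd v, fst u * snd v + snd u * fst v).
Fixpoint Cpow (u : Cx) (n : nat) : Cx :=
  match n with O => Cone | S k => Cmul u (Cpow u k) end.
Definition Cmod (u : Cx) : R := sqrt (fst u ^ 2 + snd u ^ 2).

Definition Csum (l : list Cx) : Cx := fold_right Cadd Czero l.

Definition peval (a : nat -> Cx) (d : nat) (z : Cx) : Cx :=
  Csum (map (fun k => Cmul (a k) (Cpow z k)) (seq 0 (S d))).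

Definition qeval (c : nat -> nat -> Cx) (N d : nat) (z w : Cx) : Cx :=
  Csum (map (fun ij => Cmul (c (fst ij) (snd ij))
                         (Cmul (Cpow z (fst ij)) (Cpow w (snd ij))))
            (list_prod (seq 0 (S N)) (seq 0 (S d)))).

Fixpoint piter (a : nat -> Cx) (d : nat) (n : nat) (z : Cx) : Cx :=
  match n with O => z | S k => peval a d (piter a d k z) end.

Fixpoint Qiter (a : nat -> Cx) (c : nat -> nat -> Cx) (N d : nat) (n : nat)
  (z w : Cx) : Cx :=
  match n with
  | O => w
  | S k => qeval c N d (piter a d k z) (Qiter a c N d k z w)
  end.

Definition fiter (a : nat -> Cx) (c : nat -> nat -> Cx) (N d : nat) (n : nat)
  (zw : Cx * Cx) : Cx * Cx :=
  (piter a d n (fst zw), Qiter a c N d n (fst zw) (snd zw)).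

Definition Cnonzero (u : Cx) : bool :=
  if Req_EM_T (fst u) 0 then
    (if Req_EM_T (snd u) 0 then false else true)
  else true.

(** alpha = max { (n_j - gamma)/(d - m_j) : c n_j m_j <> 0, m_j < d },
    None standing for -infinity. *)
Definition alpha (c : nat -> nat -> Cx) (N d gamma : nat) : option R :=
  let supp := filter (fun ij => Cnonzero (c (fst ij) (snd ij)))
                     (list_prod (seq 0 (S N)) (seq 0 d)) in
  let exps := map (fun ij => (INR (fst ij) - INR gamma) / (INR d - INR (snd ij)))
                  supp in
  match exps with
  | nil => None
  | x :: l => Some (fold_right Rmax x l)
  end.

Definition inW (c : nat -> nat -> Cx) (N d gamma : nat) (Rr : R) (zw : Cx * Cx)
  : Prop :=
  Cmod (fst zw) > Rr /\
  match alpha c N d gamma with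
  | None => snd zw <> Czero
  | Some al => Cmod (snd zw) > Rr * Rpower (Cmod (fst zw)) al
  end.

Definition in_Ap (a : nat -> Cx) (d : nat) (z : Cx) : Prop :=
  forall M : R, exists n0 : nat, forall n : nat, (n0 <= n)%nat ->
    Cmod (piter a d n z) > M.

Definition in_Af (a : nat -> Cx) (c : nat -> nat -> Cx) (N d gamma : nat) (Rr : R)
  (zw : Cx * Cx) : Prop :=
  exists n : nat, inW c N d gamma Rr (fiter a c N d n zw).

Definition logplus (x : R) : R := Rmax 0 (ln x).

(** The sequence d^{-n} log^+ |p^n(z)| whose limit is G_p(z). *)
Definition green_seq (a : nat -> Cx) (d : nat) (z : Cx) (n : nat) : R :=
  logplus (Cmod (piter a d n z)) / (INR d ^ n).

(* Main.v *)
(** Write [(z_n, w_n)] for the orbit. Once it has entered [W_R] with [|z_n|]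
    large, [|p(z)|] is comparable to [|z|^d] and [|q(z, w)|] to
    [|z|^gamma |w|^d], so [l_n = log |z_n|] and [L_n = log |w_n|] satisfy
    [l_(n+1) = d l_n + O(1)] and [L_(n+1) = d L_n + gamma l_n + O(1)]. Hence
    [L_n / d^n] has increments tending to [gamma G_p / d], and Cesaro's lemma
    concludes.

    The delicate point is the lower bound on [|q|]: invariance of [W_R] only
    gives [q <> 0] on [W_R], and for this given [R] the leading part of [q] along
    [w = s z^alpha] might a priori vanish at some [|s| = R]. In the coordinates
    [z = t^(-k)], [w = s z^alpha], [k alpha] an integer, the quotient
    [q(z, w) / z^(gamma + d alpha)] is a polynomial in [(s, t)] without zeros for
    [|s| > R] and small [t <> 0], bounded below on a circle [|t| = rho]; the
    minimum modulus principle carries this bound to [t = 0]. *)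

From Stdlib Require Import Reals Lra Lia List FinFun.
From mathcomp Require all_boot all_order all_algebra complex Rstruct.
From Coquelicot Require Import Coquelicot.
Require Import Defs.
Open Scope R_scope.

(** Coefficients and exponents are functions on an arbitrary index type, so one double sum over
    [(i, j)] can be read as a polynomial in [t] or in [s], with repeated exponents allowed. *)
Definition monomial_sum {I : Type} (A : I -> Cx) (e : I -> nat) (L : list I) (t : Cx) : Cx :=
  Csum (map (fun x => Cmul (A x) (Cpow t (e x))) L).

(** * Complex polynomials over an algebraically closed field *)

Module ClosedField.
Import all_boot all_order all_algebra mathcomp.real_closed.complex Rstruct.
Import Order.TTheory GRing.Theory Num.Theory.
Import ComplexField.
Set Implicit Arguments.
Unset Strict Implicit.
Unset Printing Implicit Defensive.
Local Open Scope ring_scope.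

Local Notation C := (complex R).

Definition toC (u : Cx) : C := Complex (fst u) (snd u).
Definition ofC (x : C) : Cx := (complex.Re x, complex.Im x).

Lemma ofCK : cancel ofC toC. Proof. by case. Qed.
Lemma toCK : cancel toC ofC. Proof. by case. Qed.
Lemma toC0 : toC Czero = 0. Proof. by []. Qed.
Lemma toC_add u v : toC (Cadd u v) = toC u + toC v. Proof. by []. Qed.
Lemma toC_mul u v : toC (Cmul u v) = toC u * toC v. Proof. by []. Qed.
Lemma toC_pow u n : toC (Cpow u n) = toC u ^+ n.
Proof. by elim: n => //= n IHn; rewrite toC_mul IHn exprS. Qed.

Lemma toC_norm u : `|toC u| = (Cmod u)%:C%C.
Proof. by rewrite normc_def /Cmod !RpowE RsqrtE. Qed.

Definition monomial_poly (I : Type) (A : I -> Cx) (e : I -> nat) (L : list I) : {poly C} :=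
  \sum_(x <- L) (toC (A x))%:P * 'X^(e x).

Lemma toC_monomial_sum (I : Type) (A : I -> Cx) e (L : list I) t :
  toC (monomial_sum A e L t) = (monomial_poly A e L).[toC t].
Proof.
rewrite /monomial_poly /monomial_sum; elim: L => [|x L IHL] /=.
  by rewrite big_nil horner0.
rewrite big_cons hornerD hornerM hornerC hornerXn -IHL.
by rewrite -toC_pow -toC_mul -toC_add.
Qed.

(** Algebraic closedness applied to [X^n - u]; this supplies the coordinate [u] with [z = u^k]. *)
Lemma Cpow_surj (u : Cx) (n : nat) : (0 < n)%N -> exists v, Cpow v n = u.
Proof.
move=> n_gt0.
have /closed_rootP[x /rootP] : size ('X^n - (toC u)%:P) != 1.
  by rewrite size_XnsubC // eqSS -lt0n.
rewrite !hornerE => /eqP; rewrite subr_eq0 => /eqP xn.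
exists (ofC x); apply: (can_inj toCK).
by rewrite toC_pow ofCK.
Qed.


Lemma prodr_const_seq (I : Type) (r : list I) (y : C) :
  \prod_(i <- r) y = y ^+ size r.
Proof. by rewrite big_const_seq count_predT iter_mulr_1. Qed.

(** If [a > x], then [(a / x)^n] is unbounded, whereas the hypothesis keeps it below [2^D]. *)
Lemma ler_of_exprn_le (a x : R) (D : nat) : 0 < x -> 0 <= a ->
  (forall n, (0 < n)%N -> a ^+ n <= 2 ^+ D * x ^+ n) -> a <= x.
Proof.
move=> x_gt0 a_ge0 leax; rewrite leNgt; apply/negP => lt_xa.
(* [Pow_x_infinity] gives a non-strict bound, so [b] exceeds [2^D] by one. *)
pose q : R := a / x; pose b : R := 2 ^+ D + 1.
have q_ge0 : 0 <= q by rewrite divr_ge0// ltW.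
have q_gt1 : Rgt (Rabs q) 1.
  by rewrite RabsE ger0_norm//; apply/RltP; rewrite ltr_pdivlMr// mul1r.
have [N HN] := Pow_x_infinity q q_gt1 b.
have /HN/Rge_le/RleP : Peano.ge N.+1 N by exact: Peano.le_S (Peano.le_n N).
rewrite RabsE RpowE ger0_norm ?exprn_ge0// expr_div_n.
rewrite ler_pdivlMr ?exprn_gt0// => /le_trans /(_ (leax _ (ltn0Sn N))).
by rewrite ler_pM2r ?exprn_gt0// gerDl ler10.
Qed.

(* With [g = l * prod (X - z)] and [w] ranging over the roots of [X^n - rho^n],
   the product of the [|g(w)|] is [|l|^n prod |z^n - rho^n| <= 2^deg(g) |g(0)|^n];
   now take n-th roots and let n go to infinity. *)
Lemma min_modulus (p : {poly C}) (rho m : R) : 0 < rho -> 0 <= m ->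
  (forall z, `|z| <= rho%:C%C -> p.[z] != 0) ->
  (forall z, `|z| = rho%:C%C -> m%:C%C <= `|p.[z]|) ->
  m%:C%C <= `|p.[0]|.
Proof.
move=> rho_gt0 m_ge0 p_neq0 p_ge.
set r := rho%:C%C in p_neq0 p_ge *.
have r_gt0 : 0 < r by rewrite ltcR.
have p0 : p.[0] != 0 by apply: p_neq0; rewrite normr0 ltW.
have [zs pE] := closed_field_poly_normal p.
set l := lead_coef p in pE.
have hornerp x : p.[x] = l * \prod_(z <- zs) (x - z).
  rewrite {1}pE hornerZ horner_prod; congr (_ * _).
  by apply: eq_bigr => z _; rewrite hornerXsubC.
have zs_ge z : z \in zs -> r <= `|z|.
  move=> zzs; rewrite real_leNgt ?normr_real ?gtr0_real//; apply/negP => zr.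
  have /negP := p_neq0 z (ltW zr); apply.
  by rewrite hornerp (big_rem z)//= subrr mul0r mulr0.
pose x := complex.Re `|p.[0]|.
have xE : `|p.[0]| = x%:C%C by rewrite RRe_real ?normr_real.
rewrite xE lecR; apply: (@ler_of_exprn_le m x (size zs)) => //.
  by rewrite -ltcR -xE normr_gt0.
move=> n n_gt0.
have [ws] := closed_field_poly_normal ('X^n - (r ^+ n)%:P : {poly C}).
rewrite lead_coefXnsubC// scale1r => wsE.
have horner_ws y : \prod_(w <- ws) (y - w) = y ^+ n - r ^+ n.
  have := congr1 (fun q => q.[y]) wsE.
  rewrite !hornerE horner_prod => ->.
  by apply: eq_bigr => w _; rewrite hornerXsubC.
have size_ws : size ws = n.
  have := congr1 (fun q : {poly C} => size q) wsE.
  by rewrite size_XnsubC// size_prod_XsubC => -[].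
have ws_norm w : w \in ws -> `|w| = r.
  move=> wws; apply: (@pexpIrn _ n) => //; rewrite ?nnegrE ?(ltW r_gt0)//.
  have := horner_ws w; rewrite (big_rem w)//= subrr mul0r => /esym/eqP.
  rewrite subr_eq0 -normrX => /eqP ->.
  by rewrite ger0_norm// exprn_ge0// ltW.
rewrite -lecR !rmorphM !rmorphXn/= -xE.
apply: (@le_trans _ _ (\prod_(w <- ws) `|p.[w]|)).
  rewrite -{1}size_ws -prodr_const_seq.
  rewrite big_seq [X in _ <= X]big_seq; apply: ler_prod => w wws.
  by rewrite ler0c m_ge0 p_ge// ws_norm.
under eq_bigr => w _ do rewrite hornerp normrM normr_prod.
(* Exchanging the products leaves, for each root [z] of [p], the factor
   [prod_w |w - z| = |z^n - r^n|], at most [2 |z|^n] because [|z| >= r]. *)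
rewrite big_split/= prodr_const_seq size_ws exchange_big/=.
rewrite hornerp normrM exprMn mulrCA ler_pM2l; last first.
  rewrite exprn_gt0// normr_gt0.
  by apply: contraNneq p0 => l0; rewrite hornerp l0 mul0r.
rewrite normr_prod -prodrXl rmorphD/= -prodr_const_seq -big_split/=.
rewrite big_seq [X in _ <= X]big_seq; apply: ler_prod => z zzs.
rewrite prodr_ge0//=.
under eq_bigr => w _ do rewrite distrC.
rewrite -normr_prod horner_ws (le_trans (ler_normB _ _))// mulrDl !mul1r.
rewrite sub0r normrN normrX lerD2l.
by rewrite (ger0_norm (exprn_ge0 n (ltW r_gt0))) lerXn2r ?nnegrE ?zs_ge ?(ltW r_gt0).
Qed.

Lemma monomial_sum_min_modulus (I : Type) (A : I -> Cx) e (L : list I) (rho m : R) :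
  Rlt 0 rho -> Rle 0 m ->
  (forall t, Rle (Cmod t) rho -> monomial_sum A e L t <> Czero) ->
  (forall t, Cmod t = rho -> Rle m (Cmod (monomial_sum A e L t))) ->
  Rle m (Cmod (monomial_sum A e L Czero)).
Proof.
move=> /RltP rho_gt0 /RleP m_ge0 neq0 ge_m; apply/RleP.
rewrite -lecR -toC_norm toC_monomial_sum toC0; apply: (min_modulus rho_gt0) => // z.
  rewrite -[z]ofCK toC_norm lecR -toC_monomial_sum => /RleP/neq0/eqP.
  by apply: contraNneq => /(congr1 ofC)/=; rewrite toCK => ->.
rewrite -[z]ofCK toC_norm -toC_monomial_sum toC_norm lecR => /complexI/ge_m/RleP.
exact.
Qed.

(** A nonzero polynomial [p] has fewer than [size p] roots, so one of [size p] distinct points near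
    [s0] is not a root. *)
Lemma monomial_sum_nonroot_near (I : Type) (A : I -> Cx) e (L : list I) s1 s0 delta :
  monomial_sum A e L s1 <> Czero -> Rlt 0 delta ->
  exists h, Rlt (Cmod h) delta /\ monomial_sum A e L (Cadd s0 h) <> Czero.
Proof.
move=> s1_nroot /RltP delta_gt0.
set p := monomial_poly A e L.
have p_neq0 : p != 0.
  apply: contra_not_neq s1_nroot => p0.
  by apply: (can_inj toCK); rewrite toC_monomial_sum -/p p0 horner0.
(* Dividing by [k.+2] keeps even the first shift strictly below [delta]. *)
pose ep (k : nat) : C := (delta / k.+2%:R)%:C%C.
have ep_inj : injective ep.
  move=> i j /complexI/(mulfI (lt0r_neq0 delta_gt0))/invr_inj/eqP.
  by rewrite eqr_nat => /eqP[].
pose xs := [seq toC s0 + ep k | k <- iota 0 (size p)].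
have : ~~ all (root p) xs.
  apply/negP => /(max_poly_roots p_neq0).
  rewrite map_inj_uniq ?iota_uniq ?size_map ?size_iota ?ltnn//.
    by move/(_ isT).
  by move=> i j /addrI/ep_inj.
case/allPn => _ /mapP[k _ ->] nroot; exists (ofC (ep k)); split.
  apply/RltP; rewrite -ltcR -toC_norm ofCK ger0_norm.
    by rewrite ltcR ltr_pdivrMr// ltr_pMr// (ltr_nat _ 1).
  by rewrite ler0c divr_ge0// ltW.
move=> /(congr1 toC); rewrite toC_monomial_sum toC_add ofCK => /eqP.
by rewrite -/(root p _) (negPf nroot).
Qed.

End ClosedField.

(** * Arithmetic and modulus of complex pairs *)

Lemma Cx_semiring : semi_ring_theory Czero Cone Cadd Cmul eq.
Proof.
  split; unfold Czero, Cone, Cadd, Cmul; intros;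
    repeat match goal with u : Cx |- _ => destruct u end;
    simpl; f_equal; ring.
Qed.

Add Ring Cx_ring : Cx_semiring.

Lemma Cmod_mul u v : Cmod (Cmul u v) = Cmod u * Cmod v.
Proof. exact (Complex.Cmod_mult u v). Qed.

Lemma Cmod_add_le u v : Cmod (Cadd u v) <= Cmod u + Cmod v.
Proof. exact (Complex.Cmod_triangle u v). Qed.

Lemma Cmod_ge0 u : 0 <= Cmod u.
Proof. exact (Complex.Cmod_ge_0 u). Qed.

Lemma Cmod_zero : Cmod Czero = 0.
Proof. exact Complex.Cmod_0. Qed.

Lemma Cmod_one : Cmod Cone = 1.
Proof. exact Complex.Cmod_1. Qed.

Lemma Cmod_eq0 u : Cmod u = 0 -> u = Czero.
Proof. exact (Complex.Cmod_eq_0 u). Qed.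

Lemma Cmod_gt0 u : u <> Czero -> 0 < Cmod u.
Proof. apply Complex.Cmod_gt_0. Qed.

Lemma Cmod_pow u n : Cmod (Cpow u n) = Cmod u ^ n.
Proof.
  induction n as [|n IH]; simpl; [apply Cmod_one|].
  now rewrite Cmod_mul, IH.
Qed.

Lemma Cmod_add_ge u v : Cmod u - Cmod v <= Cmod (Cadd u v).
Proof.
  assert (H := Cmod_add_le (Cadd u v) (Cmul (-1, 0) v)).
  rewrite Cmod_mul in H.
  replace (Cmod (-1, 0)) with 1 in H
    by (unfold Cmod; simpl; replace (_ + _) with 1 by ring; now rewrite sqrt_1).
  replace (Cadd (Cadd u v) (Cmul (-1, 0) v)) with u in H
    by (destruct u, v; unfold Cadd, Cmul; simpl; f_equal; ring).
  lra.
Qed.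

Lemma Cmul_inv_ex u : u <> Czero -> exists v, Cmul u v = Cone.
Proof. intros H; exists (Complex.Cinv u); exact (Complex.Cinv_r u H). Qed.

Lemma Cpow_add u m n : Cpow u (m + n) = Cmul (Cpow u m) (Cpow u n).
Proof. induction m as [|m IH]; simpl; [|rewrite IH]; ring. Qed.

Lemma Cpow_mul_base u v n : Cpow (Cmul u v) n = Cmul (Cpow u n) (Cpow v n).
Proof. induction n as [|n IH]; simpl; [|rewrite IH]; ring. Qed.

Lemma Cpow_mul u m n : Cpow u (m * n) = Cpow (Cpow u m) n.
Proof.
  induction m as [|m IH]; simpl.
  - induction n as [|n IHn]; simpl; [|rewrite <- IHn]; ring.
  - now rewrite Cpow_add, IH, Cpow_mul_base.
Qed.

Lemma Cpow_one n : Cpow Cone n = Cone.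
Proof. induction n as [|n IH]; simpl; [|rewrite IH]; ring. Qed.

Lemma Cpow_zero n : (0 < n)%nat -> Cpow Czero n = Czero.
Proof. destruct n; [lia|]; intros _; simpl; ring. Qed.

Lemma Cpow_cancel u t m n : Cmul u t = Cone -> (n <= m)%nat ->
  Cmul (Cpow t m) (Cpow u n) = Cpow t (m - n).
Proof.
  intros Hut Hle. replace m with (m - n + n)%nat at 1 by lia.
  rewrite Cpow_add.
  transitivity (Cmul (Cpow t (m - n)) (Cpow (Cmul u t) n)).
  - rewrite Cpow_mul_base; ring.
  - rewrite Hut, Cpow_one; ring.
Qed.

(** * Finite sums with a dominant term *)

Definition Rsum (l : list R) : R := fold_right Rplus 0 l.

Lemma Rsum_ge0 {I} (B : I -> R) (L : list I) :
  (forall x, 0 <= B x) -> 0 <= Rsum (map B L).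
Proof.
  intros HB; induction L as [|x L IH]; simpl; [lra|]. specialize (HB x). lra.
Qed.

Lemma Csum_le {I} (f : I -> Cx) (B : I -> R) (r : R) (L : list I) :
  (forall x, In x L -> Cmod (f x) <= B x * r) ->
  Cmod (Csum (map f L)) <= Rsum (map B L) * r.
Proof.
  induction L as [|x L IH]; simpl; intros H.
  - unfold Csum; simpl. rewrite Cmod_zero; lra.
  - assert (Hx := H x (or_introl eq_refl)).
    assert (HL := IH (fun y Hy => H y (or_intror Hy))).
    assert (Ht := Cmod_add_le (f x) (Csum (map f L))).
    change (Cmod (Cadd (f x) (Csum (map f L))) <= (B x + Rsum (map B L)) * r).
    lra.
Qed.

Lemma Csum_add {I} (f g : I -> Cx) (L : list I) :
  Csum (map (fun x => Cadd (f x) (g x)) L) = Cadd (Csum (map f L)) (Csum (map g L)).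
Proof.
  induction L as [|x L IH]; unfold Csum in *; simpl; [|rewrite IH]; ring.
Qed.

Lemma Csum_scale {I} (k : Cx) (f : I -> Cx) (L : list I) :
  Cmul k (Csum (map f L)) = Csum (map (fun x => Cmul k (f x)) L).
Proof.
  induction L as [|x L IH]; unfold Csum in *; simpl; [|rewrite <- IH]; ring.
Qed.

Lemma Csum_cancel {I} (f : I -> Cx) (L : list I) (x0 : I) :
  NoDup L -> In x0 L ->
  exists L', incl L' L /\ ~ In x0 L' /\
    Csum (map f L) = Cadd (f x0) (Csum (map f L')) /\
    forall B : I -> R, (forall x, 0 <= B x) -> Rsum (map B L') <= Rsum (map B L).
Proof.
  intros Hnd Hin; destruct (in_split _ _ Hin) as [l1 [l2 ->]].
  exists (l1 ++ l2). repeat split.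
  - intros y Hy. apply in_app_or in Hy; apply in_or_app; simpl; tauto.
  - now apply NoDup_remove_2.
  - clear; induction l1 as [|y l1 IH]; unfold Csum in *; simpl; [|rewrite IH]; ring.
  - intros B HB. clear -HB; induction l1 as [|y l1 IH]; simpl; [specialize (HB x0)|]; lra.
Qed.

(** Triangle inequality after removing [x0], which [NoDup] makes the only occurrence; the remaining
    weights are enlarged to the whole list, so the constant is a plain coefficient sum. *)
Lemma Csum_dominant {I} (f : I -> Cx) (B : I -> R) (r : R) (L : list I) (x0 : I) :
  NoDup L -> In x0 L -> (forall x, 0 <= B x) -> 0 <= r ->
  (forall x, In x L -> x <> x0 -> Cmod (f x) <= B x * r) ->
  Cmod (f x0) - Rsum (map B L) * r <= Cmod (Csum (map f L))
  <= Cmod (f x0) + Rsum (map B L) * r.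
Proof.
  intros Hnd Hin HB Hr H.
  destruct (Csum_cancel f L x0 Hnd Hin) as [L' [Hincl [Hn [-> HL']]]].
  assert (Hle : Cmod (Csum (map f L')) <= Rsum (map B L') * r).
  { apply Csum_le; intros x Hx; apply H; [now apply Hincl|intros ->; auto]. }
  assert (Hs := Rmult_le_compat_r r _ _ Hr (HL' B HB)).
  assert (H1 := Cmod_add_le (f x0) (Csum (map f L'))).
  assert (H2 := Cmod_add_ge (f x0) (Csum (map f L'))).
  lra.
Qed.

Lemma NoDup_list_prod {I J} (l : list I) (l' : list J) :
  NoDup l -> NoDup l' -> NoDup (list_prod l l').
Proof.
  intros Hl Hl'; induction Hl as [|x l Hx Hl IH]; simpl; [constructor|].
  apply NoDup_app; [|exact IH|].
  - apply Injective_map_NoDup; [|exact Hl'].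
    intros y y' E; now inversion E.
  - intros [x' y] H H'. apply in_map_iff in H as [y' [E _]].
    apply in_prod_iff in H'. inversion E; subst; tauto.
Qed.

(** * Perturbation of polynomials *)

Lemma Cpow_shift s n : exists K, 0 <= K /\ forall y, Cmod y <= 1 ->
  exists r, Cmod r <= K /\ Cpow (Cadd s y) n = Cadd (Cpow s n) (Cmul y r).
Proof.
  induction n as [|n [K [HK IH]]].
  - exists 0; split; [lra|]; intros y _; exists Czero; rewrite Cmod_zero.
    split; [lra|]; simpl; ring.
  (* The remainder comes from [(s + y)(s^n + y r) = s^(n+1) + y (s r + s^n + y r)] and
     [|y| <= 1]. *)
  - exists (Cmod s * K + Cmod s ^ n + K). split.
    { assert (H1 := pow_le _ n (Cmod_ge0 s)). assert (H2 := Cmod_ge0 s). nra. }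
    intros y Hy. destruct (IH y Hy) as [r [Hr E]].
    exists (Cadd (Cadd (Cmul s r) (Cpow s n)) (Cmul y r)). split.
    + eapply Rle_trans; [apply Cmod_add_le|].
      assert (H1 := Cmod_add_le (Cmul s r) (Cpow s n)).
      rewrite !Cmod_mul, Cmod_pow in *.
      assert (H2 := Cmod_ge0 s). assert (H3 := Cmod_ge0 y). assert (H4 := Cmod_ge0 r).
      nra.
    + simpl. rewrite E. ring.
Qed.

Lemma monomial_sum_shift {I} (A : I -> Cx) e L s : exists K, 0 <= K /\
  forall y, Cmod y <= 1 -> exists r, Cmod r <= K /\
    monomial_sum A e L (Cadd s y) = Cadd (monomial_sum A e L s) (Cmul y r).
Proof.
  unfold monomial_sum; induction L as [|x L [K [HK IH]]].
  - exists 0; split; [lra|]; intros y _; exists Czero; rewrite Cmod_zero.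
    split; [lra|]; unfold Csum; simpl; ring.
  - destruct (Cpow_shift s (e x)) as [K' [HK' H']].
    exists (Cmod (A x) * K' + K). split; [assert (H := Cmod_ge0 (A x)); nra|].
    intros y Hy. destruct (IH y Hy) as [r [Hr E]]. destruct (H' y Hy) as [r' [Hr' E']].
    exists (Cadd (Cmul (A x) r') r). split.
    + eapply Rle_trans; [apply Cmod_add_le|]. rewrite Cmod_mul.
      assert (H := Cmod_ge0 (A x)). nra.
    + unfold Csum in *; simpl. rewrite E, E'. ring.
Qed.

(** Terms of exponent zero give the value at [0]; every other term carries a factor [t], and
    [|t|^e <= |t|] for [e >= 1]. *)
Lemma monomial_sum_near0 {I} (A : I -> Cx) e L t : Cmod t <= 1 ->
  Cmod (monomial_sum A e L Czero) - Rsum (map (fun x => Cmod (A x)) L) * Cmod t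
  <= Cmod (monomial_sum A e L t).
Proof.
  intros Ht.
  pose (g := fun x => match e x with O => Czero | S _ => Cmul (A x) (Cpow t (e x)) end).
  assert (E : monomial_sum A e L t
              = Cadd (monomial_sum A e L Czero) (Csum (map g L))).
  { unfold monomial_sum; rewrite <- Csum_add; f_equal; apply map_ext; intros x.
    unfold g; destruct (e x); simpl; ring. }
  assert (H : Cmod (Csum (map g L)) <= Rsum (map (fun x => Cmod (A x)) L) * Cmod t).
  { apply Csum_le; intros x _. unfold g.
    assert (Ha := Cmod_ge0 (A x)). assert (Ht0 := Cmod_ge0 t).
    destruct (e x) as [|n]; [rewrite Cmod_zero; nra|].
    rewrite Cmod_mul, Cmod_pow; apply Rmult_le_compat_l; [lra|]. simpl.
    assert (Hp := pow_le _ n Ht0).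
    assert (Cmod t ^ n <= 1) by (rewrite <- (pow1 n); apply pow_incr; lra). nra. }
  rewrite E. assert (H2 := Cmod_add_ge (monomial_sum A e L Czero) (Csum (map g L))). lra.
Qed.

(** * Convergence of perturbed linear recurrences *)

Lemma pow_increment_cv (x : nat -> R) (C : R) (n0 : nat) :
  (forall n, (n0 <= n)%nat -> Rabs (x (S n) - x n) <= C * (/ 2) ^ n) ->
  exists l, Un_cv x l.
Proof.
  intros H.
  assert (HC : 0 <= C).
  { assert (Hn := H n0 (Nat.le_refl _)).
    assert (Hp : 0 < (/ 2) ^ n0) by (apply pow_lt; lra).
    assert (Ha := Rabs_pos (x (S n0) - x n0)). nra. }
  (* Keeping the exact partial geometric sum, instead of its bound [2 * C * (/ 2)^n], lets the
     induction on [k] close. *)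
  assert (Hk : forall n k, (n0 <= n)%nat ->
    Rabs (x (n + k)%nat - x n) <= 2 * C * ((/ 2) ^ n - (/ 2) ^ (n + k))).
  { intros n k Hn; induction k as [|k IH].
    - rewrite Nat.add_0_r, Rminus_diag, Rabs_R0; lra.
    - rewrite Nat.add_succ_r.
      assert (H1 := H (n + k)%nat ltac:(lia)).
      replace (x (S (n + k)) - x n)
        with ((x (S (n + k)) - x (n + k)%nat) + (x (n + k)%nat - x n)) by ring.
      eapply Rle_trans; [apply Rabs_triang|]. simpl. lra. }
  destruct (Rcomplete.R_complete x) as [l Hl]; [|now exists l].
  intros eps Heps.
  (* The summand [1] in [4 * C + 1] keeps the divisor positive when [C = 0]. *)
  destruct (pow_lt_1_zero (/ 2) ltac:(rewrite Rabs_pos_eq; lra) (eps / (4 * C + 1))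
              ltac:(apply Rdiv_lt_0_compat; lra)) as [N HN].
  assert (Hlt : forall n k, (n0 <= n)%nat -> (N <= n)%nat ->
            Rabs (x (n + k)%nat - x n) < eps).
  { intros n k Hn HNn. eapply Rle_lt_trans; [now apply Hk|].
    assert (H1 := HN n HNn). rewrite Rabs_pos_eq in H1 by (apply pow_le; lra).
    assert (Hp : 0 < (/ 2) ^ (n + k)) by (apply pow_lt; lra).
    assert (Hp1 : 0 < (/ 2) ^ n) by (apply pow_lt; lra).
    assert ((/ 2) ^ n * (4 * C + 1) < eps).
    { apply Rmult_lt_reg_r with (/ (4 * C + 1)); [apply Rinv_0_lt_compat; lra|].
      rewrite Rmult_assoc, Rinv_r by lra. unfold Rdiv in H1. lra. }
    nra. }
  exists (max n0 N). intros n m Hn Hm. unfold Rdist.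
  destruct (Nat.le_ge_cases n m) as [Hnm|Hnm].
  - replace m with (n + (m - n))%nat by lia. rewrite Rabs_minus_sym. apply Hlt; lia.
  - replace n with (m + (n - m))%nat by lia. apply Hlt; lia.
Qed.

(* [L n / d^n] has increments tending to [gam * G / d], so by Cesaro it grows
   like [n * gam * G / d]. *)
Lemma resonant_recurrence_cv (l L : nat -> R) (d gam C : R) (n0 : nat) :
  2 <= d -> 0 < gam ->
  (forall n, (n0 <= n)%nat -> Rabs (l (S n) - d * l n) <= C) ->
  (forall n, (n0 <= n)%nat -> Rabs (L (S n) - gam * l n - d * L n) <= C) ->
  exists G, Un_cv (fun n => l n / d ^ n) G /\
            Un_cv (fun n => L n / (INR n * gam * d ^ (n - 1))) G.
Proof.
  intros Hd Hg Hl HL.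
  assert (HC : 0 <= C) by (eapply Rle_trans; [apply Rabs_pos|apply (Hl n0); lia]).
  assert (Hdn : forall n, 0 < d ^ n) by (intros; apply pow_lt; lra).
  assert (Hdinv : forall n, / d ^ n <= (/ 2) ^ n).
  { intros n; rewrite pow_inv. apply Rinv_le_contravar; [apply pow_lt; lra|].
    apply pow_incr; lra. }
  assert (Hdiv : forall x n, Rabs x <= C -> Rabs (x / d ^ S n) <= C * (/ 2) ^ n).
  { intros x n Hx. unfold Rdiv. rewrite Rabs_mult.
    rewrite (Rabs_pos_eq (/ d ^ S n)) by (left; apply Rinv_0_lt_compat, Hdn).
    apply Rmult_le_compat; auto using Rabs_pos.
    - left; apply Rinv_0_lt_compat, Hdn.
    - eapply Rle_trans; [apply Hdinv|]. simpl.
      assert (0 < (/ 2) ^ n) by (apply pow_lt; lra). lra. }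
  destruct (pow_increment_cv (fun n => l n / d ^ n) C n0) as [G HG].
  { intros n Hn. replace (l (S n) / d ^ S n - l n / d ^ n)
      with ((l (S n) - d * l n) / d ^ S n)
      by (simpl; field; split; [specialize (Hdn n)|]; lra).
    now apply Hdiv, Hl. }
  exists G; split; [exact HG|].
  set (y := fun n => L n / d ^ n).
  assert (Hy : Un_cv (fun n => y (S n) - y n) (gam * G / d)).
  { apply is_lim_seq_Reals.
    (* The increment of [y] is [gam / d] times [l n / d^n] plus an error that decays geometrically
       by the recurrence for [L]. *)
    apply is_lim_seq_ext with
      (fun n => gam / d * (l n / d ^ n) + (y (S n) - y n - gam / d * (l n / d ^ n))).
    { intros n; ring. }
    replace (gam * G / d) with (gam / d * G + 0) by (field; lra).
    apply is_lim_seq_plus'.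
    - apply is_lim_seq_mult'; [apply is_lim_seq_const|now apply is_lim_seq_Reals].
    - apply is_lim_seq_abs_0.
      apply is_lim_seq_le_le_loc with (fun _ => 0) (fun n => C * (/ 2) ^ n).
      + exists n0; intros n Hn; split; [apply Rabs_pos|].
        unfold y. replace (L (S n) / d ^ S n - L n / d ^ n - gam / d * (l n / d ^ n))
          with ((L (S n) - gam * l n - d * L n) / d ^ S n)
          by (simpl; field; split; [specialize (Hdn n)|]; lra).
        now apply Hdiv, HL.
      + apply is_lim_seq_const.
      + replace (Finite 0) with (Finite (C * 0)) by (f_equal; ring).
        apply is_lim_seq_mult'; [apply is_lim_seq_const|].
        apply is_lim_seq_geom. rewrite Rabs_pos_eq; lra. }
  apply Cesaro_1, is_lim_seq_Reals in Hy. apply is_lim_seq_Reals.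
  assert (Hsum : forall n, sum_f_R0 (fun k => y (S k) - y k) n = y (S n) - y O).
  { induction n as [|n IH]; simpl; [|rewrite IH]; ring. }
  (* The averaged increments telescope to [(y n - y 0) / n]; restoring [y 0 / n] and multiplying by
     [d / gam] gives the target. The identity is used from [n = 1] on, where [n - 1] is a true
     predecessor. *)
  apply is_lim_seq_ext_loc with (fun n =>
    d / gam * (sum_f_R0 (fun k => y (S k) - y k) (Init.Nat.pred n) / INR n
               + y O * / INR n)).
  { exists 1%nat; intros [|n] Hn; [lia|]. cbn [Init.Nat.pred]. rewrite Hsum.
    replace (S n - 1)%nat with n by lia. unfold y.
    assert (0 < INR (S n)) by (apply lt_0_INR; lia).
    cbn [pow]. field. repeat split; try lra. specialize (Hdn n); lra. }
  replace G with (d / gam * (gam * G / d + y O * 0)) by (field; lra).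
  apply is_lim_seq_mult'; [apply is_lim_seq_const|].
  apply is_lim_seq_plus'; [exact Hy|].
  apply is_lim_seq_mult'; [apply is_lim_seq_const|].
  apply (is_lim_seq_inv _ p_infty is_lim_seq_INR). discriminate.
Qed.

(** * The exponent alpha and real powers *)

Lemma Cnonzero_spec u : Cnonzero u = true <-> u <> Czero.
Proof.
  unfold Cnonzero, Czero; destruct u as [x y]; simpl.
  destruct (Req_EM_T x 0); [destruct (Req_EM_T y 0)|]; split; intros H; congruence.
Qed.

Lemma fold_Rmax_in x l : In (fold_right Rmax x l) (x :: l).
Proof.
  induction l as [|y l IH]; simpl; [now left|].
  destruct (Rmax_case_strong y (fold_right Rmax x l) (fun m => m = y \/ m = fold_right Rmax x l))
    as [->| ->]; auto; simpl in IH; tauto.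
Qed.

Lemma fold_Rmax_ge x l y : In y (x :: l) -> y <= fold_right Rmax x l.
Proof.
  induction l as [|z l IH]; simpl; intros H; [destruct H as [->|[]]; lra|].
  destruct H as [->|[->|H]].
  - eapply Rle_trans; [apply IH; now left|apply Rmax_r].
  - apply Rmax_l.
  - eapply Rle_trans; [apply IH; now right|apply Rmax_r].
Qed.

(** Attainment of the maximum makes alpha a fraction with denominator [d - j], which is what permits
    the coordinate [z = u^k]. *)
Lemma alpha_spec c N d gamma :
  match alpha c N d gamma with
  | None => forall i j, (i <= N)%nat -> (j < d)%nat -> c i j = Czero
  | Some al =>
      (exists i j, (j < d)%nat /\ al = (INR i - INR gamma) / (INR d - INR j)) /\
      forall i j, (i <= N)%nat -> (j < d)%nat -> c i j <> Czero ->
        (INR i - INR gamma) / (INR d - INR j) <= al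
  end.
Proof.
  unfold alpha.
  set (supp := filter _ _).
  set (sl := fun ij : nat * nat => (INR (fst ij) - INR gamma) / (INR d - INR (snd ij))).
  assert (Hs : forall i j, (i <= N)%nat -> (j < d)%nat -> c i j <> Czero ->
            In (sl (i, j)) (map sl supp)).
  { intros i j Hi Hj Hc. apply in_map, filter_In; split.
    - apply in_prod_iff; split; apply in_seq; lia.
    - now apply Cnonzero_spec. }
  assert (Hd : forall y, In y (map sl supp) -> exists i j, (j < d)%nat /\ y = sl (i, j)).
  { intros y Hy. apply in_map_iff in Hy as [[i j] [<- Hy]].
    apply filter_In in Hy as [Hy _]. apply in_prod_iff in Hy as [_ Hy].
    apply in_seq in Hy. exists i, j; split; [lia|reflexivity]. }
  destruct (map sl supp) as [|x l].
  - intros i j Hi Hj. destruct (Cnonzero (c i j)) eqn:E.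
    + apply Cnonzero_spec in E. destruct (Hs i j Hi Hj E).
    + destruct (Req_EM_T (Cmod (c i j)) 0) as [E0|E0]; [now apply Cmod_eq0|].
      assert (H : c i j <> Czero) by (intros H; rewrite H, Cmod_zero in E0; lra).
      apply Cnonzero_spec in H. congruence.
  - split.
    + apply Hd, fold_Rmax_in.
    + intros i j Hi Hj Hc. now apply (fold_Rmax_ge x l (sl (i, j))), Hs.
Qed.

(** Passing to a [k]-th root of [|z|] clears the denominator of alpha. *)
Lemma Rpower_pow_ratio x k n g : 0 < x -> (0 < k)%nat ->
  Rpower (x ^ k) ((INR n - INR g) / INR k) = x ^ n / x ^ g.
Proof.
  intros Hx Hk.
  assert (INR k <> 0) by (apply not_0_INR; lia).
  rewrite <- !Rpower_pow by assumption.
  rewrite Rpower_mult.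
  replace (INR k * ((INR n - INR g) / INR k)) with (INR n + - INR g) by now field.
  now rewrite Rpower_plus, Rpower_Ropp.
Qed.

(** [ln x] lies in [[0, ln b]], and [- Rabs al] covers both signs of the exponent. *)
Lemma Rpower_lower_bound a b x al : 1 <= a -> a <= x <= b ->
  exp (- Rabs al * ln b) <= Rpower x al.
Proof.
  intros Ha Hx. unfold Rpower.
  assert (H0 : 0 <= ln x) by (rewrite <- ln_1; apply ln_le; lra).
  assert (H1 : ln x <= ln b) by (apply ln_le; lra).
  assert (H2 := Rabs_pos al). assert (H3 := Rle_abs (- al)). rewrite Rabs_Ropp in H3.
  destruct (Req_dec (- Rabs al * ln b) (al * ln x)) as [->|]; [lra|].
  left; apply exp_increasing. nra.
Qed.

(** * The rescaled polynomial and its uniform lower bound *)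

Definition qsupport (N d : nat) : list (nat * nat) :=
  list_prod (seq 0 (S N)) (seq 0 (S d)).

Lemma qsupport_NoDup N d : NoDup (qsupport N d).
Proof. apply NoDup_list_prod; apply seq_NoDup. Qed.

Lemma in_qsupport N d i j : In (i, j) (qsupport N d) <-> (i <= N)%nat /\ (j <= d)%nat.
Proof. unfold qsupport; rewrite in_prod_iff, !in_seq; lia. Qed.

Definition qcoeff_sum (c : nat -> nat -> Cx) (N d : nat) : R :=
  Rsum (map (fun ij => Cmod (c (fst ij) (snd ij))) (qsupport N d)).

Lemma qcoeff_sum_ge0 c N d : 0 <= qcoeff_sum c N d.
Proof. apply Rsum_ge0; intros; apply Cmod_ge0. Qed.

(* All monomials of [q] lie below the line of slope [-(n - gamma) / k] through
   [(gamma, d)], that is [k (i - gamma) <= (n - gamma) (d - j)], stated without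
   subtraction. *)
Definition below_line (c : nat -> nat -> Cx) (N d gamma k n : nat) : Prop :=
  forall i j, (i <= N)%nat -> (j <= d)%nat -> c i j <> Czero ->
    (d * gamma + k * i + j * n <= k * gamma + d * n + j * gamma)%nat.

(** This is [(n - gamma)(d - j) - k (i - gamma)] expanded. The subtraction is exact on the monomials
    of [q] by [below_line]; where it truncates, the coefficient is zero. *)
Definition rescaled_exp (d gamma k n : nat) (ij : nat * nat) : nat :=
  (k * gamma + d * n + snd ij * gamma) - (d * gamma + k * fst ij + snd ij * n).

(* [q(z, w) / z^(gamma + d alpha)] in the coordinates [z = t^(-k)],
   [w = s z^alpha] with [alpha = (n - gamma) / k]; a polynomial in [s] and [t]. *)
Definition rescaled (c : nat -> nat -> Cx) (N d gamma k n : nat) (s t : Cx) : Cx :=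
  monomial_sum (fun ij => Cmul (c (fst ij) (snd ij)) (Cpow s (snd ij)))
    (rescaled_exp d gamma k n) (qsupport N d) t.

(** With [u = 1/t], the prefactor is [z^(-gamma - d alpha)] and [s u^n t^gamma] is [s z^alpha];
    using both [u] and [t] avoids negative powers. *)
Lemma rescaled_qeval c N d gamma k n s t u :
  below_line c N d gamma k n -> Cmul u t = Cone ->
  rescaled c N d gamma k n s t =
  Cmul (Cmul (Cpow t (k * gamma + d * n)) (Cpow u (d * gamma)))
    (qeval c N d (Cpow u k) (Cmul s (Cmul (Cpow u n) (Cpow t gamma)))).
Proof.
  intros Hbl Hut. unfold rescaled, monomial_sum, qeval.
  rewrite Csum_scale. f_equal. apply map_ext_in. intros [i j] Hij.
  apply in_qsupport in Hij as [Hi Hj]. cbn [fst snd].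
  destruct (Req_EM_T (Cmod (c i j)) 0) as [E|E].
  { apply Cmod_eq0 in E. rewrite E. ring. }
  assert (Hc : c i j <> Czero) by (intros H; rewrite H, Cmod_zero in E; lra).
  unfold rescaled_exp; cbn [fst snd].
  rewrite <- (Cpow_cancel u t _ _ Hut (Hbl i j Hi Hj Hc)).
  rewrite !Cpow_add, !Cpow_mul_base, !Cpow_mul.
  rewrite <- !Cpow_mul, (Nat.mul_comm n j), (Nat.mul_comm gamma j).
  ring.
Qed.

Lemma Cmod_inverse u t : Cmul u t = Cone -> 0 < Cmod u /\ Cmod t = / Cmod u.
Proof.
  intros H. assert (E : Cmod u * Cmod t = 1) by now rewrite <- Cmod_mul, H, Cmod_one.
  assert (H0 : Cmod u <> 0) by (intros H0; rewrite H0 in E; lra).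
  assert (H1 := Cmod_ge0 u). split; [lra|].
  apply Rmult_eq_reg_l with (Cmod u); [|lra]. rewrite E, Rinv_r; lra.
Qed.

(** At [t = 0] a monomial with [j = d] and [i < gamma] vanishes, its exponent being
    [k (gamma - i) > 0]. So [s^d] has coefficient one and all else has degree at most [d - 1] in
    [s]. *)
Lemma rescaled_zero_dominant c N d gamma k n s :
  (1 <= k)%nat -> (1 <= d)%nat -> (gamma <= N)%nat -> c gamma d = Cone ->
  (forall i, (gamma < i)%nat -> c i d = Czero) -> 1 <= Cmod s ->
  Cmod s ^ d - qcoeff_sum c N d * Cmod s ^ (d - 1)
    <= Cmod (rescaled c N d gamma k n s Czero).
Proof.
  intros Hk Hd HgN Hlead Hdeg Hs.
  set (f := fun ij : nat * nat => Cmul (Cmul (c (fst ij) (snd ij)) (Cpow s (snd ij)))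
                     (Cpow Czero (rescaled_exp d gamma k n ij))).
  destruct (Csum_dominant f (fun ij => Cmod (c (fst ij) (snd ij))) (Cmod s ^ (d - 1))
    (qsupport N d) (gamma, d)) as [H _].
  - apply qsupport_NoDup.
  - apply in_qsupport; lia.
  - intros; apply Cmod_ge0.
  - apply pow_le, Cmod_ge0.
  - intros [i j] Hij Hne. apply in_qsupport in Hij as [Hi Hj].
    unfold f; cbn [fst snd].
    assert (Hc := Cmod_ge0 (c i j)).
    assert (Hp : 0 <= Cmod s ^ (d - 1)) by apply pow_le, Cmod_ge0.
    destruct (Nat.eq_dec j d) as [->|Hjd].
    + replace (Cmul (Cmul (c i d) (Cpow s d)) (Cpow Czero (rescaled_exp d gamma k n (i, d))))
        with Czero; [rewrite Cmod_zero; nra|].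
      destruct (Nat.lt_ge_cases gamma i) as [Hi'|Hi'].
      * rewrite (Hdeg i Hi'). ring.
      * assert (i <> gamma) by congruence.
        rewrite (Cpow_zero (rescaled_exp d gamma k n (i, d))); [ring|].
        unfold rescaled_exp; cbn [fst snd]. nia.
    + rewrite !Cmod_mul, !Cmod_pow, Rmult_assoc. apply Rmult_le_compat_l; [lra|].
      rewrite <- (Rmult_1_r (Cmod s ^ (d - 1))).
      apply Rmult_le_compat; try (apply pow_le, Cmod_ge0).
      * apply Rle_pow; [lra|lia].
      * rewrite Cmod_zero. rewrite <- (pow1 (rescaled_exp d gamma k n (i, j))).
        apply pow_incr; lra.
  - replace (Cmod (f (gamma, d))) with (Cmod s ^ d) in H; [exact H|].
    unfold f, rescaled_exp; cbn [fst snd]. rewrite Hlead.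
    replace (_ - _)%nat with 0%nat by lia. simpl.
    rewrite <- Cmod_pow. f_equal. ring.
Qed.

Lemma rescaled_upper c N d gamma k n s t : 1 <= Cmod s -> Cmod t <= 1 ->
  Cmod (rescaled c N d gamma k n s t) <= qcoeff_sum c N d * Cmod s ^ d.
Proof.
  intros Hs Ht. apply Csum_le. intros [i j] Hij. cbn [fst snd].
  apply in_qsupport in Hij as [_ Hj].
  rewrite !Cmod_mul, !Cmod_pow, Rmult_assoc.
  apply Rmult_le_compat_l; [apply Cmod_ge0|].
  rewrite <- (Rmult_1_r (Cmod s ^ d)).
  apply Rmult_le_compat; try (apply pow_le, Cmod_ge0).
  - apply Rle_pow; assumption.
  - rewrite <- (pow1 (rescaled_exp d gamma k n (i, j))).
    apply pow_incr; split; [apply Cmod_ge0|lra].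
Qed.

Lemma rescaled_lower c N d gamma k n s t : 1 <= Cmod s -> Cmod t <= 1 ->
  Cmod (rescaled c N d gamma k n s Czero) - qcoeff_sum c N d * Cmod s ^ d * Cmod t
    <= Cmod (rescaled c N d gamma k n s t).
Proof.
  intros Hs Ht. unfold rescaled.
  eapply Rle_trans; [|now apply monomial_sum_near0].
  apply Rplus_le_compat_l, Ropp_le_contravar, Rmult_le_compat_r; [apply Cmod_ge0|].
  unfold qcoeff_sum.
  assert (H : forall L, (forall ij, In ij L -> (snd ij <= d)%nat) ->
    Rsum (map (fun x => Cmod (Cmul (c (fst x) (snd x)) (Cpow s (snd x)))) L)
    <= Rsum (map (fun ij => Cmod (c (fst ij) (snd ij))) L) * Cmod s ^ d).
  { induction L as [|x L IH]; simpl; intros H; [lra|].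
    assert (H1 := IH (fun y Hy => H y (or_intror Hy))).
    rewrite Cmod_mul, Cmod_pow.
    assert (H2 : Cmod s ^ snd x <= Cmod s ^ d)
      by (apply Rle_pow; [lra|apply H; now left]).
    assert (H3 := Cmod_ge0 (c (fst x) (snd x))). nra. }
  apply H. intros [i j] Hij. now apply in_qsupport in Hij.
Qed.

(* For [s] with [rescaled s 0 <> 0], the polynomial [rescaled s] has no zero in
   [|t| <= rho], so by the minimum modulus principle [|rescaled s 0|] is bounded
   below by the minimum over [|t| = rho]. Such [s] are dense. *)
Lemma rescaled_zero_lower_bound c N d gamma k n Rr rho m :
  0 < rho -> 0 < m ->
  (exists s, rescaled c N d gamma k n s Czero <> Czero) ->
  (forall s t, Rr < Cmod s -> t <> Czero -> Cmod t <= rho ->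
     rescaled c N d gamma k n s t <> Czero) ->
  (forall s t, Rr < Cmod s -> Cmod t = rho -> m <= Cmod (rescaled c N d gamma k n s t)) ->
  forall s, Rr < Cmod s -> m <= Cmod (rescaled c N d gamma k n s Czero).
Proof.
  intros Hrho Hm [s1 Hs1] Hnz Hge.
  assert (Hgen : forall s, Rr < Cmod s -> rescaled c N d gamma k n s Czero <> Czero ->
            m <= Cmod (rescaled c N d gamma k n s Czero)).
  { intros s Hs Hs0. apply ClosedField.monomial_sum_min_modulus with rho; try lra.
    - intros t Ht. destruct (Req_EM_T (Cmod t) 0) as [E|E].
      + apply Cmod_eq0 in E. now subst.
      + apply Hnz; auto. intros ->. apply E, Cmod_zero.
    - intros t Ht. now apply Hge. }
  intros s Hs.
  destruct (Req_EM_T (Cmod (rescaled c N d gamma k n s Czero)) 0) as [E|E];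
    [|apply Hgen; [exact Hs|]; intros H; rewrite H in E; now apply E, Cmod_zero].
  exfalso.
  (* At [t = 0] the sum is reread as a polynomial in [s], the powers of zero being absorbed in the
     coefficients. *)
  set (A := fun ij : nat * nat => Cmul (c (fst ij) (snd ij))
               (Cpow Czero (rescaled_exp d gamma k n ij))).
  assert (EA : forall s, rescaled c N d gamma k n s Czero
                         = monomial_sum A snd (qsupport N d) s).
  { intros s'. unfold rescaled, monomial_sum. f_equal; apply map_ext; intros ij.
    unfold A; ring. }
  destruct (monomial_sum_shift A snd (qsupport N d) s) as [K [HK HKs]].
  (* The three bounds make the shift estimate available, keep [|s + h| > Rr], and force the value at
     [s + h] below [m], contradicting the bound at nonroots. *)
  set (delta := Rmin 1 (Rmin (Cmod s - Rr) (m / (K + 1)))).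
  assert (Hdelta : 0 < delta).
  { repeat apply Rmin_glb_lt; try lra. apply Rdiv_lt_0_compat; lra. }
  destruct (@ClosedField.monomial_sum_nonroot_near _ A snd (qsupport N d) s1 s delta)
    as [h [Hh Hsh]]; [now rewrite <- EA|exact Hdelta|].
  assert (Hd1 : delta <= 1) by apply Rmin_l.
  assert (Hd2 : delta <= Cmod s - Rr)
    by (eapply Rle_trans; [apply Rmin_r|apply Rmin_l]).
  assert (Hd3 : delta <= m / (K + 1))
    by (eapply Rle_trans; [apply Rmin_r|apply Rmin_r]).
  destruct (HKs h ltac:(lra)) as [r [Hr Er]].
  assert (Hlow : m <= Cmod (rescaled c N d gamma k n (Cadd s h) Czero)).
  { apply Hgen; [|now rewrite EA].
    assert (H := Cmod_add_ge s h). lra. }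
  apply Cmod_eq0 in E. rewrite EA in Hlow, E. rewrite Er, E in Hlow.
  replace (Cadd Czero (Cmul h r)) with (Cmul h r) in Hlow by ring.
  rewrite Cmod_mul in Hlow.
  assert (Hq : Cmod h * (K + 1) < m).
  { apply Rmult_lt_reg_r with (/ (K + 1)); [apply Rinv_0_lt_compat; lra|].
    rewrite Rmult_assoc, Rinv_r by lra. unfold Rdiv in Hd3. lra. }
  assert (H1 := Cmod_ge0 h). assert (H2 := Cmod_ge0 r). nra.
Qed.

(** At [t = 0] the leading power handles large [|s|] and the minimum modulus bound handles the rest.
    Moving off [t = 0] costs at most [K |s|^d |t|], also proportional to [|s|^d], so one [t0] serves
    all [s]. *)
Lemma rescaled_uniform_lower_bound c N d gamma k n Rr rho m :
  (1 <= k)%nat -> (1 <= d)%nat -> (gamma <= N)%nat -> c gamma d = Cone ->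
  (forall i, (gamma < i)%nat -> c i d = Czero) -> 1 < Rr -> 0 < rho -> 0 < m ->
  (forall s t, Rr < Cmod s -> t <> Czero -> Cmod t <= rho ->
     rescaled c N d gamma k n s t <> Czero) ->
  (forall s t, Rr < Cmod s -> Cmod t = rho -> m <= Cmod (rescaled c N d gamma k n s t)) ->
  exists c1 t0, 0 < c1 /\ 0 < t0 <= 1 /\ forall s t, Rr < Cmod s -> Cmod t <= t0 ->
    c1 * Cmod s ^ d <= Cmod (rescaled c N d gamma k n s t).
Proof.
  intros Hk Hd HgN Hlead Hdeg HR Hrho Hm Hnz Hge.
  set (K := qcoeff_sum c N d). assert (HK : 0 <= K) by apply qcoeff_sum_ge0.
  (* For [|s| >= 2 * K] the lower-order part [K |s|^(d-1)] is at most half of [|s|^d]. *)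
  set (S0 := 2 * K + Rr).
  assert (Hbig : forall s, S0 <= Cmod s ->
            / 2 * Cmod s ^ d <= Cmod (rescaled c N d gamma k n s Czero)).
  { intros s Hs. unfold S0 in Hs.
    assert (E : Cmod s ^ d = Cmod s * Cmod s ^ (d - 1))
      by (replace d with (S (d - 1)) at 1 by lia; reflexivity).
    assert (H := rescaled_zero_dominant c N d gamma k n s Hk Hd HgN Hlead Hdeg ltac:(lra)).
    fold K in H. rewrite E in *.
    assert (Hp : 0 < Cmod s ^ (d - 1)) by (apply pow_lt; lra). nra. }
  assert (Hnonzero : exists s, rescaled c N d gamma k n s Czero <> Czero).
  { exists (S0, 0). intros E.
    assert (ES : Cmod (S0, 0) = S0).
    { unfold Cmod; simpl. replace (_ + _) with (S0 * S0) by ring.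
      apply sqrt_square. unfold S0; lra. }
    assert (H := Hbig (S0, 0) ltac:(rewrite ES; lra)).
    rewrite E, Cmod_zero, ES in H.
    assert (0 < S0 ^ d) by (apply pow_lt; unfold S0; lra). lra. }
  assert (Hsmall := rescaled_zero_lower_bound c N d gamma k n Rr rho m
                      Hrho Hm Hnonzero Hnz Hge).
  assert (HS0d : 0 < S0 ^ d) by (apply pow_lt; unfold S0; lra).
  (* [m / S0^d] turns the constant bound [m] into a multiple of [|s|^d] on [|s| <= S0]. *)
  set (c1 := Rmin (/ 2) (m / S0 ^ d)).
  assert (Hc1 : 0 < c1) by (apply Rmin_glb_lt; [lra|now apply Rdiv_lt_0_compat]).
  assert (Hzero : forall s, Rr < Cmod s ->
            c1 * Cmod s ^ d <= Cmod (rescaled c N d gamma k n s Czero)).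
  { intros s Hs. assert (Hsd : 0 <= Cmod s ^ d) by apply pow_le, Cmod_ge0.
    destruct (Rle_dec S0 (Cmod s)) as [H|H].
    - eapply Rle_trans; [|now apply Hbig].
      apply Rmult_le_compat_r; [lra|apply Rmin_l].
    - eapply Rle_trans; [|now apply Hsmall].
      assert (Cmod s ^ d <= S0 ^ d) by (apply pow_incr; split; [apply Cmod_ge0|lra]).
      apply Rle_trans with (m / S0 ^ d * S0 ^ d).
      + apply Rmult_le_compat; try lra. apply Rmin_r.
      + right; field; lra. }
  (* This [t0] gives [K |t| <= c1 / 2], so half of the bound at [t = 0] survives. *)
  exists (c1 / 2), (Rmin 1 (c1 / (2 * K + 1))).
  assert (Ht0 : 0 < c1 / (2 * K + 1)) by (apply Rdiv_lt_0_compat; lra).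
  split; [lra|split; [split; [apply Rmin_glb_lt; lra|apply Rmin_l]|]].
  intros s t Hs Ht.
  assert (Ht1 : Cmod t <= 1) by (eapply Rle_trans; [exact Ht|apply Rmin_l]).
  assert (Ht2 : Cmod t <= c1 / (2 * K + 1)) by (eapply Rle_trans; [exact Ht|apply Rmin_r]).
  assert (H1 := rescaled_lower c N d gamma k n s t ltac:(lra) Ht1). fold K in H1.
  assert (H2 := Hzero s Hs).
  assert (H3 : Cmod t * (2 * K + 1) <= c1).
  { apply Rmult_le_reg_r with (/ (2 * K + 1)); [apply Rinv_0_lt_compat; lra|].
    rewrite Rmult_assoc, Rinv_r by lra. unfold Rdiv in Ht2. lra. }
  assert (H4 : 0 <= Cmod s ^ d) by apply pow_le, Cmod_ge0.
  assert (H5 := Cmod_ge0 t).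
  assert (H6 : K * Cmod t <= c1 / 2) by lra.
  assert (H7 := Rmult_le_compat_r _ _ _ H4 H6). lra.
Qed.

(** * Growth of p, and of q on the invariant region *)

(** The leading term dominates for large [|z|]. The cruder bound from [|z| >= 1] on serves a fixed
    circle that may lie below [Z0]. *)
Lemma peval_bounds (a : nat -> Cx) d : (1 <= d)%nat -> a d = Cone ->
  exists Z0 C1, 1 <= Z0 /\ 0 <= C1 /\
    (forall z, Z0 <= Cmod z ->
       / 2 * Cmod z ^ d <= Cmod (peval a d z) <= 2 * Cmod z ^ d) /\
    (forall z, 1 <= Cmod z -> Cmod (peval a d z) <= C1 * Cmod z ^ d).
Proof.
  intros Hd Hlead.
  set (K := Rsum (map (fun i => Cmod (a i)) (seq 0 (S d)))).
  assert (HK : 0 <= K) by (apply Rsum_ge0; intros; apply Cmod_ge0).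
  exists (2 * K + 1), (1 + K). split; [lra|split; [lra|]].
  assert (H : forall z, 1 <= Cmod z ->
    Cmod z ^ d - K * Cmod z ^ (d - 1) <= Cmod (peval a d z)
      <= Cmod z ^ d + K * Cmod z ^ (d - 1)).
  { intros z Hz.
    replace (Cmod z ^ d) with (Cmod (Cmul (a d) (Cpow z d)))
      by (rewrite Hlead, Cmod_mul, Cmod_one, Cmod_pow; ring).
    apply (Csum_dominant (fun i => Cmul (a i) (Cpow z i)) (fun i => Cmod (a i))).
    - apply seq_NoDup.
    - apply in_seq; lia.
    - intros; apply Cmod_ge0.
    - apply pow_le, Cmod_ge0.
    - intros i Hi Hne. apply in_seq in Hi. rewrite Cmod_mul, Cmod_pow.
      apply Rmult_le_compat_l; [apply Cmod_ge0|]. apply Rle_pow; [lra|lia]. }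
  assert (E : forall z, Cmod z ^ d = Cmod z * Cmod z ^ (d - 1))
    by (intros z; replace d with (S (d - 1)) at 1 by lia; reflexivity).
  split; intros z Hz; specialize (H z ltac:(lra)); rewrite E in *;
    assert (Hp : 0 < Cmod z ^ (d - 1)) by (apply pow_lt; lra).
  - assert (K * Cmod z ^ (d - 1) <= / 2 * (Cmod z * Cmod z ^ (d - 1))) by nra. lra.
  - assert (Hle : Cmod z ^ (d - 1) <= Cmod z * Cmod z ^ (d - 1)) by nra.
    assert (Hle' := Rmult_le_compat_l K _ _ HK Hle). lra.
Qed.

(** Since [|w| = |s| |z|^alpha] in these coordinates, the second inequality defining [W_R] is just
    [|s| > R]. *)
Lemma inW_of_rescaled c N d gamma Rr k n s t u :
  alpha c N d gamma = Some ((INR n - INR gamma) / INR k) -> (1 <= k)%nat ->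
  Cmul u t = Cone -> Rr < Cmod u ^ k -> Rr < Cmod s ->
  inW c N d gamma Rr (Cpow u k, Cmul s (Cmul (Cpow u n) (Cpow t gamma))).
Proof.
  intros Hal Hk Hut Hu Hs. destruct (Cmod_inverse u t Hut) as [Hu0 Ht].
  unfold inW; cbn [fst snd]. rewrite Hal, !Cmod_mul, !Cmod_pow. split; [lra|].
  rewrite Rpower_pow_ratio, Ht, pow_inv by (assumption || lia).
  apply Rmult_lt_compat_r; [|exact Hs].
  apply Rmult_lt_0_compat; [|apply Rinv_0_lt_compat]; now apply pow_lt.
Qed.

Lemma rescaled_of_inW c N d gamma Rr k n z w :
  alpha c N d gamma = Some ((INR n - INR gamma) / INR k) -> (1 <= k)%nat -> 0 < Rr ->
  inW c N d gamma Rr (z, w) ->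
  exists u t s, Cmul u t = Cone /\ z = Cpow u k /\
    w = Cmul s (Cmul (Cpow u n) (Cpow t gamma)) /\ Rr < Cmod s.
Proof.
  intros Hal Hk HR [Hz Hw]; cbn [fst snd] in *. rewrite Hal in Hw.
  destruct (ClosedField.Cpow_surj z (n := k)) as [u <-].
  { destruct k; [lia|reflexivity]. }
  assert (Hu : u <> Czero).
  { intros ->. rewrite Cpow_zero, Cmod_zero in Hz by lia. lra. }
  destruct (Cmul_inv_ex u Hu) as [t Hut]. destruct (Cmod_inverse u t Hut) as [Hu0 Ht].
  exists u, t, (Cmul w (Cmul (Cpow t n) (Cpow u gamma))).
  assert (E : forall j, Cmul (Cpow u j) (Cpow t j) = Cone)
    by (intros; rewrite <- Cpow_mul_base, Hut; apply Cpow_one).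
  repeat split; [exact Hut| |].
  - transitivity (Cmul w (Cmul (Cmul (Cpow u n) (Cpow t n))
                               (Cmul (Cpow u gamma) (Cpow t gamma)))); [|ring].
    rewrite !E. ring.
  - rewrite Cmod_pow, Rpower_pow_ratio in Hw by (assumption || lia).
    rewrite !Cmod_mul, !Cmod_pow, Ht, pow_inv.
    assert (Hn : 0 < Cmod u ^ n) by now apply pow_lt.
    assert (Hg : 0 < Cmod u ^ gamma) by now apply pow_lt.
    apply Rmult_lt_reg_r with (Cmod u ^ n / Cmod u ^ gamma);
      [now apply Rdiv_lt_0_compat|].
    replace (Cmod w * (/ Cmod u ^ n * Cmod u ^ gamma) * (Cmod u ^ n / Cmod u ^ gamma))
      with (Cmod w) by (field; split; lra).
    exact Hw.
Qed.

Lemma Cmod_rescaled c N d gamma k n s t u :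
  below_line c N d gamma k n -> Cmul u t = Cone ->
  Cmod (rescaled c N d gamma k n s t) =
  Cmod u ^ (d * gamma) / Cmod u ^ (k * gamma + d * n) *
  Cmod (qeval c N d (Cpow u k) (Cmul s (Cmul (Cpow u n) (Cpow t gamma)))).
Proof.
  intros Hbl Hut. destruct (Cmod_inverse u t Hut) as [Hu0 Ht].
  rewrite (rescaled_qeval c N d gamma k n s t u Hbl Hut).
  rewrite Cmod_mul, (Cmod_mul (Cpow t _)), !(Cmod_pow _ (_ * _)), (Cmod_pow t), Ht, pow_inv.
  field. apply pow_nonzero; lra.
Qed.

(* Invariance of [W_R] only says that [q <> 0] there, with no uniform bound a
   priori; uniformity comes from [rescaled_uniform_lower_bound]. *)
Lemma qeval_bounds_on_W_slope (a : nat -> Cx) c N d gamma Rr k n :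
  (1 <= d)%nat -> a d = Cone -> (gamma <= N)%nat -> c gamma d = Cone ->
  (forall i, (gamma < i)%nat -> c i d = Czero) -> 1 < Rr ->
  (forall zw, inW c N d gamma Rr zw -> inW c N d gamma Rr (fiter a c N d 1 zw)) ->
  alpha c N d gamma = Some ((INR n - INR gamma) / INR k) -> (1 <= k)%nat ->
  below_line c N d gamma k n ->
  exists c1 C1 Z0, 0 < c1 /\ 0 < C1 /\ forall z w, inW c N d gamma Rr (z, w) ->
    Z0 <= Cmod z ->
    c1 * (Cmod z ^ gamma * Cmod w ^ d) <= Cmod (qeval c N d z w)
      <= C1 * (Cmod z ^ gamma * Cmod w ^ d).
Proof.
  intros Hd Ha HgN Hlead Hdeg HR HfW Hal Hk Hbl.
  destruct (peval_bounds a d Hd Ha) as [_ [Cp [_ [HCp [_ Hpu]]]]].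
  set (al := (INR n - INR gamma) / INR k) in *.
  assert (Hpow : forall x, 2 * Rr <= x -> 2 * Rr <= x ^ k).
  { intros x Hx. rewrite <- (pow_1 x) in Hx. eapply Rle_trans; [exact Hx|].
    apply Rle_pow; [simpl in Hx; lra|lia]. }
  assert (HW : forall s t u, Cmul u t = Cone -> 2 * Rr <= Cmod u -> Rr < Cmod s ->
    Rr < Cmod (peval a d (Cpow u k)) /\
    Rr * Rpower (Cmod (peval a d (Cpow u k))) al
      < Cmod (qeval c N d (Cpow u k) (Cmul s (Cmul (Cpow u n) (Cpow t gamma))))).
  { intros s t u Hut Hu Hs.
    destruct (HfW (Cpow u k, Cmul s (Cmul (Cpow u n) (Cpow t gamma)))) as [H1 H2].
    - apply inW_of_rescaled; auto. assert (H := Hpow _ Hu). lra.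
    - rewrite Hal in H2. split; [exact H1|exact H2]. }
  assert (Hinv : forall t, t <> Czero -> Cmod t <= / (2 * Rr) ->
            exists u, Cmul u t = Cone /\ 2 * Rr <= Cmod u).
  { intros t Ht Ht'. destruct (Cmul_inv_ex t Ht) as [u Hu]. exists u.
    split; [rewrite <- Hu; ring|].
    destruct (Cmod_inverse t u Hu) as [Ht0 ->].
    rewrite <- (Rinv_inv (2 * Rr)). now apply Rinv_le_contravar. }
  (* On the circle [|u| = 2 * Rr], [M] bounds [|p(z)|] and [X] is the rescaling factor; invariance
     gives [|q| > R |p(z)|^alpha], hence the lower bound [m] for [rescaled] on [|t| = 1 / (2R)]. *)
  set (M := Cp * ((2 * Rr) ^ k) ^ d).
  set (X := (2 * Rr) ^ (d * gamma) / (2 * Rr) ^ (k * gamma + d * n)).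
  assert (HX : 0 < X) by (apply Rdiv_lt_0_compat; apply pow_lt; lra).
  set (m := X * (Rr * exp (- Rabs al * ln M))).
  destruct (rescaled_uniform_lower_bound c N d gamma k n Rr (/ (2 * Rr)) m)
    as [c1 [t0 [Hc1 [[Ht0 Ht01] Hlow]]]]; auto.
  - apply Rinv_0_lt_compat; lra.
  - apply Rmult_lt_0_compat; [exact HX|].
    apply Rmult_lt_0_compat; [lra|apply exp_pos].
  - intros s t Hs Ht Ht'. destruct (Hinv t Ht Ht') as [u [Hut Hu]].
    destruct (HW s t u Hut Hu Hs) as [_ Hq].
    assert (Hq0 : 0 < Rr * Rpower (Cmod (peval a d (Cpow u k))) al)
      by (apply Rmult_lt_0_compat; [lra|apply exp_pos]).
    intros E. apply (f_equal Cmod) in E.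
    rewrite (Cmod_rescaled c N d gamma k n s t u Hbl Hut), Cmod_zero in E.
    assert (0 < Cmod u ^ (d * gamma) / Cmod u ^ (k * gamma + d * n))
      by (apply Rdiv_lt_0_compat; apply pow_lt; lra).
    nra.
  - intros s t Hs Ht.
    assert (Htn : t <> Czero).
    { intros ->. rewrite Cmod_zero in Ht.
      assert (0 < / (2 * Rr)) by (apply Rinv_0_lt_compat; lra). lra. }
    destruct (Hinv t Htn ltac:(lra)) as [u [Hut Hu]].
    assert (Eu : Cmod u = 2 * Rr).
    { destruct (Cmod_inverse u t Hut) as [_ Et]. rewrite Ht in Et.
      apply Rinv_eq_reg. now symmetry. }
    destruct (HW s t u Hut Hu Hs) as [Hp Hq].
    rewrite (Cmod_rescaled c N d gamma k n s t u Hbl Hut), Eu. unfold m. fold X.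
    apply Rmult_le_compat_l; [lra|]. eapply Rle_trans; [|left; exact Hq].
    apply Rmult_le_compat_l; [lra|]. apply Rpower_lower_bound with Rr; [lra|].
    split; [lra|]. unfold M. rewrite <- Eu, <- Cmod_pow. apply Hpu.
    rewrite Cmod_pow, Eu. assert (H := Hpow (2 * Rr) ltac:(lra)). lra.
  (* As [|z| = |t|^(-k)], the threshold [(/ t0)^k] on [|z|] amounts to [|t| <= t0]. *)
  - exists c1, (qcoeff_sum c N d + 1), ((/ t0) ^ k).
    assert (HK := qcoeff_sum_ge0 c N d).
    split; [exact Hc1|split; [lra|]].
    intros z w Hzw Hz.
    destruct (rescaled_of_inW c N d gamma Rr k n z w Hal Hk ltac:(lra) Hzw)
      as [u [t [s [Hut [-> [-> Hs]]]]]].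
    destruct (Cmod_inverse u t Hut) as [Hu0 Et].
    assert (Ht : Cmod t <= t0).
    { rewrite Et, <- (Rinv_inv t0).
      apply Rinv_le_contravar; [now apply Rinv_0_lt_compat|].
      apply Rnot_lt_le; intros Hlt. rewrite Cmod_pow in Hz.
      apply (Rle_not_lt _ _ Hz).
      destruct k as [|k']; [lia|].
      assert (H1 : Cmod u ^ k' <= (/ t0) ^ k') by (apply pow_incr; lra).
      assert (H2 : 0 < Cmod u ^ k') by now apply pow_lt.
      simpl. nra. }
    assert (H1 := Hlow s t Hs Ht).
    assert (H2 := rescaled_upper c N d gamma k n s t ltac:(lra) ltac:(lra)).
    rewrite (Cmod_rescaled c N d gamma k n s t u Hbl Hut) in H1, H2.
    set (q := Cmod (qeval _ _ _ _ _)) in *.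
    rewrite !Cmod_mul, !Cmod_pow, Et, !Rpow_mult_distr, !pow_inv, <- !pow_mult.
    rewrite pow_add, (Nat.mul_comm d n) in H1, H2. rewrite (Nat.mul_comm gamma d).
    assert (Hsd : 0 < Cmod s ^ d) by (apply pow_lt; lra).
    assert (P1 : 0 < Cmod u ^ (d * gamma)) by now apply pow_lt.
    assert (P2 : 0 < Cmod u ^ (k * gamma)) by now apply pow_lt.
    assert (P3 : 0 < Cmod u ^ (n * d)) by now apply pow_lt.
    set (x := Cmod u ^ (d * gamma)) in *. set (y := Cmod u ^ (k * gamma)) in *.
    set (v := Cmod u ^ (n * d)) in *. set (sd := Cmod s ^ d) in *.
    (* [y * v / x] is [|z|^(gamma + d alpha)]; multiplying by it undoes the rescaling. *)
    assert (HY : 0 < y * v / x)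
      by (apply Rdiv_lt_0_compat; [now apply Rmult_lt_0_compat|assumption]).
    replace (y * (sd * (v * / x))) with (y * v / x * sd) by (field; lra).
    replace q with (y * v / x * (x / (y * v) * q)) by (field; repeat split; lra).
    split.
    + assert (H3 := Rmult_le_compat_l _ _ _ (Rlt_le _ _ HY) H1). lra.
    + assert (H3 := Rmult_le_compat_l _ _ _ (Rlt_le _ _ HY) H2).
      assert (0 < y * v / x * sd) by now apply Rmult_lt_0_compat. lra.
Qed.

(** Here [q = b(z) w^d]: the factor [w^d] splits off, and the lower terms of the monic [b] are
    bounded through [|z|^(gamma - 1)]. *)
Lemma qeval_bounds_on_W_product c N d gamma Rr :
  (1 <= gamma <= N)%nat -> c gamma d = Cone ->
  (forall i, (gamma < i)%nat -> c i d = Czero) ->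
  alpha c N d gamma = None ->
  exists c1 C1 Z0, 0 < c1 /\ 0 < C1 /\ forall z w, inW c N d gamma Rr (z, w) ->
    Z0 <= Cmod z ->
    c1 * (Cmod z ^ gamma * Cmod w ^ d) <= Cmod (qeval c N d z w)
      <= C1 * (Cmod z ^ gamma * Cmod w ^ d).
Proof.
  intros Hg Hlead Hdeg Hal.
  assert (Hspec := alpha_spec c N d gamma). rewrite Hal in Hspec.
  set (K := qcoeff_sum c N d). assert (HK : 0 <= K) by apply qcoeff_sum_ge0.
  exists (/ 2), 2, (2 * K + 1). split; [lra|split; [lra|]].
  intros z w _ Hz.
  assert (Hw : 0 <= Cmod w ^ d) by apply pow_le, Cmod_ge0.
  assert (Hp : 0 < Cmod z ^ (gamma - 1)) by (apply pow_lt; lra).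
  destruct (Csum_dominant
    (fun ij => Cmul (c (fst ij) (snd ij)) (Cmul (Cpow z (fst ij)) (Cpow w (snd ij))))
    (fun ij => Cmod (c (fst ij) (snd ij))) (Cmod z ^ (gamma - 1) * Cmod w ^ d)
    (qsupport N d) (gamma, d)) as [H1 H2].
  - apply qsupport_NoDup.
  - apply in_qsupport; lia.
  - intros; apply Cmod_ge0.
  - nra.
  - intros [i j] Hij Hne. apply in_qsupport in Hij as [Hi Hj]. cbn [fst snd].
    rewrite !Cmod_mul, !Cmod_pow.
    destruct (Nat.eq_dec j d) as [->|Hjd].
    + destruct (Nat.lt_ge_cases gamma i) as [Hi'|Hi'].
      * rewrite (Hdeg i Hi'), Cmod_zero. lra.
      * assert (i <> gamma) by congruence.
        apply Rmult_le_compat_l; [apply Cmod_ge0|].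
        apply Rmult_le_compat_r; [exact Hw|]. apply Rle_pow; [lra|lia].
    + rewrite (Hspec i j) by lia. rewrite Cmod_zero. lra.
  - fold (qcoeff_sum c N d) in H1, H2. fold K in H1, H2. cbn [fst snd] in H1, H2.
    rewrite Hlead, !Cmod_mul, !Cmod_pow, Cmod_one in H1, H2.
    change (Csum (map _ (qsupport N d))) with (qeval c N d z w) in H1, H2.
    assert (E : Cmod z ^ gamma = Cmod z * Cmod z ^ (gamma - 1))
      by (replace gamma with (S (gamma - 1)) at 1 by lia; reflexivity).
    rewrite E in *.
    set (y := Cmod z ^ (gamma - 1) * Cmod w ^ d) in *.
    assert (Hy : 0 <= y) by (apply Rmult_le_pos; lra).
    assert (E2 : Cmod z * Cmod z ^ (gamma - 1) * Cmod w ^ d = Cmod z * y)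
      by (unfold y; ring).
    rewrite E2 in *.
    assert (K * y <= / 2 * (Cmod z * y)) by nra. lra.
Qed.

Lemma qeval_bounds_on_W (a : nat -> Cx) c N d gamma Rr :
  (1 <= d)%nat -> a d = Cone -> (1 <= gamma <= N)%nat -> c gamma d = Cone ->
  (forall i, (gamma < i)%nat -> c i d = Czero) -> 1 < Rr ->
  (forall zw, inW c N d gamma Rr zw -> inW c N d gamma Rr (fiter a c N d 1 zw)) ->
  exists c1 C1 Z0, 0 < c1 /\ 0 < C1 /\ forall z w, inW c N d gamma Rr (z, w) ->
    Z0 <= Cmod z ->
    c1 * (Cmod z ^ gamma * Cmod w ^ d) <= Cmod (qeval c N d z w)
      <= C1 * (Cmod z ^ gamma * Cmod w ^ d).
Proof.
  intros Hd Ha Hg Hlead Hdeg HR HfW.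
  assert (Hspec := alpha_spec c N d gamma).
  destruct (alpha c N d gamma) as [al|] eqn:Hal.
  2: now apply qeval_bounds_on_W_product.
  destruct Hspec as [[n [j0 [Hj0 Eal]]] Hmax].
  rewrite <- (minus_INR d j0) in Eal by lia. subst al.
  (* The monomial [(n, j0)] attains alpha, so [k = d - j0]. Then [below_line] is maximality of alpha
     cross-multiplied when [j < d], and the degree bound on [b] when [j = d]. *)
  apply qeval_bounds_on_W_slope with a (d - j0)%nat n; auto; try lia.
  intros i j Hi Hj Hc.
  destruct (Nat.eq_dec j d) as [->|Hjd].
  - assert (i <= gamma)%nat.
    { apply Nat.nlt_ge; intros H. now apply Hc, Hdeg. }
    nia.
  - assert (H := Hmax i j Hi ltac:(lia) Hc).
    assert (Hk : 0 < INR (d - j0)) by (apply lt_0_INR; lia).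
    assert (Hj' : 0 < INR (d - j)) by (apply lt_0_INR; lia).
    rewrite <- (minus_INR d j) in H by lia.
    assert (H' : (INR i - INR gamma) * INR (d - j0) <= (INR n - INR gamma) * INR (d - j)).
    { apply Rmult_le_reg_r with (/ INR (d - j)); [now apply Rinv_0_lt_compat|].
      apply Rmult_le_reg_r with (/ INR (d - j0)); [now apply Rinv_0_lt_compat|].
      unfold Rdiv in H. field_simplify in H; try lra. field_simplify; lra. }
    apply INR_le. rewrite (minus_INR d j) in H' by lia.
    rewrite !plus_INR, !mult_INR. lra.
Qed.

(** * Logarithms along the orbit and the limit *)

Lemma ln_product_bound c1 C1 x y : 0 < c1 -> 0 < C1 -> 0 < y ->
  c1 * y <= x <= C1 * y -> 0 < x /\ Rabs (ln x - ln y) <= Rabs (ln c1) + Rabs (ln C1).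
Proof.
  intros Hc HC Hy [H1 H2].
  assert (H0 : 0 < c1 * y) by now apply Rmult_lt_0_compat.
  assert (Hx : 0 < x) by lra. split; [exact Hx|].
  apply ln_le in H1, H2; try assumption.
  rewrite ln_mult in H1, H2 by assumption.
  assert (H3 := Rle_abs (- ln c1)). rewrite Rabs_Ropp in H3.
  assert (H4 := Rle_abs (ln C1)).
  assert (H5 := Rabs_pos (ln c1)). assert (H6 := Rabs_pos (ln C1)).
  apply Rabs_le; lra.
Qed.

Lemma inW_fiter_ge a c N d gamma Rr z w n0 :
  (forall zw, inW c N d gamma Rr zw -> inW c N d gamma Rr (fiter a c N d 1 zw)) ->
  inW c N d gamma Rr (fiter a c N d n0 (z, w)) ->
  forall n, (n0 <= n)%nat ->
    inW c N d gamma Rr (piter a d n z, Qiter a c N d n z w).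
Proof.
  intros HfW H0 n Hn; induction Hn as [|n Hn IH]; [exact H0|].
  exact (HfW _ IH).
Qed.

Lemma piter_add a d m n z : piter a d (m + n) z = piter a d m (piter a d n z).
Proof. induction m as [|m IH]; simpl; congruence. Qed.

Lemma inW_snd_gt0 c N d gamma Rr z w : 0 < Rr ->
  inW c N d gamma Rr (z, w) -> 0 < Cmod w.
Proof.
  intros HR [_ H]; cbn [fst snd] in H. destruct (alpha c N d gamma) as [al|].
  - eapply Rlt_trans; [|exact H]. apply Rmult_lt_0_compat; [lra|apply exp_pos].
  - now apply Cmod_gt0.
Qed.

Theorem theorem6p10
  (d : nat) (hd : (2 <= d)%nat)
  (a : nat -> Cx) (ha : a d = Cone)
  (N gamma : nat) (c : nat -> nat -> Cx)
  (hgamma1 : (1 <= gamma)%nat) (hgammaN : (gamma <= N)%nat)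
  (hb_lead : c gamma d = Cone)
  (hb_deg : forall i : nat, (gamma < i)%nat -> c i d = Czero)
  (Rr : R) (hR : 1 < Rr)
  (hfW : forall zw : Cx * Cx, inW c N d gamma Rr zw ->
           inW c N d gamma Rr (fiter a c N d 1 zw))
  (hWA : forall zw : Cx * Cx, inW c N d gamma Rr zw -> in_Ap a d (fst zw))
  (z w : Cx) (hzw : in_Af a c N d gamma Rr (z, w)) :
  exists Gpz : R,
    Un_cv (green_seq a d z) Gpz /\
    Un_cv (fun n => ln (Cmod (Qiter a c N d n z w))
                    / (INR n * INR gamma * INR d ^ (n - 1))) Gpz.
Proof.
  destruct hzw as [n1 Hn1].
  assert (HW := inW_fiter_ge a c N d gamma Rr z w n1 hfW Hn1).
  assert (Hesc := hWA _ Hn1). cbn [fiter fst] in Hesc.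
  destruct (peval_bounds a d ltac:(lia) ha) as [Zp [_ [HZp [_ [Hp _]]]]].
  destruct (qeval_bounds_on_W a c N d gamma Rr ltac:(lia) ha (conj hgamma1 hgammaN)
              hb_lead hb_deg hR hfW) as [c1 [C1 [Zq [Hc1 [HC1 Hq]]]]].
  destruct (Hesc (Rmax Zp Zq)) as [n2 Hn2].
  (* The orbit is in [W_R] from time [n1] on, and [n2] further steps bring [|z_n|] above both
     thresholds for good. *)
  set (n0 := (n1 + n2)%nat).
  assert (Hz : forall n, (n0 <= n)%nat ->
            Zp <= Cmod (piter a d n z) /\ Zq <= Cmod (piter a d n z)).
  { intros n Hn. assert (H := Hn2 (n - n1)%nat ltac:(unfold n0 in Hn; lia)).
    rewrite <- piter_add in H. replace (n - n1 + n1)%nat with n in H by (unfold n0 in Hn; lia).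
    assert (H1 := Rmax_l Zp Zq). assert (H2 := Rmax_r Zp Zq). lra. }
  (* [l] uses the [log^+] of [green_seq]; from [n0] on it is the plain logarithm, as
     [|z_n| >= Zp >= 1]. *)
  set (l := fun n => logplus (Cmod (piter a d n z))).
  assert (Hl : forall n, (n0 <= n)%nat -> l n = ln (Cmod (piter a d n z))).
  { intros n Hn. destruct (Hz n Hn) as [H _]. apply Rmax_right.
    rewrite <- ln_1. apply ln_le; lra. }
  destruct (resonant_recurrence_cv l (fun n => ln (Cmod (Qiter a c N d n z w)))
    (INR d) (INR gamma)
    (Rmax (Rabs (ln (/ 2)) + Rabs (ln 2)) (Rabs (ln c1) + Rabs (ln C1))) n0)
    as [G [HG1 HG2]].
  - change 2 with (INR 2). now apply le_INR.
  - apply lt_0_INR; lia.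
  - intros n Hn. rewrite !Hl by lia. destruct (Hz n Hn) as [H _].
    eapply Rle_trans; [|apply Rmax_l].
    replace (INR d * ln (Cmod (piter a d n z))) with (ln (Cmod (piter a d n z) ^ d))
      by (rewrite ln_pow; lra).
    apply ln_product_bound; [lra|lra|apply pow_lt; lra|]. exact (Hp _ H).
  - intros n Hn. rewrite Hl by lia. destruct (Hz n Hn) as [H H'].
    assert (HWn := HW n ltac:(unfold n0 in Hn; lia)).
    assert (Hw := inW_snd_gt0 c N d gamma Rr _ _ ltac:(lra) HWn).
    assert (Hz0 : 0 < Cmod (piter a d n z)) by lra.
    eapply Rle_trans; [|apply Rmax_r].
    rewrite <- !ln_pow by assumption.
    unfold Rminus. rewrite Rplus_assoc, <- Ropp_plus_distr.
    rewrite <- ln_mult by now apply pow_lt.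
    apply ln_product_bound; [lra|lra|apply Rmult_lt_0_compat; now apply pow_lt|].
    exact (Hq _ _ HWn H').
  - exists G. split; [exact HG1|exact HG2].
Qed.
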